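(* Let $N\ge1$ and, for $p\in\{0,1,\dots,N-1\}$, let $\varpi^{(N,p)}_p\in(\mathbb C^2)^{\otimes N}$ be a linear combination of the permutations of $\underbrace{e_1\otimes\cdots\otimes e_1}_{N-p}\otimes\underbrace{e_2\otimes\cdots\otimes e_2}_{p}$ such that $\mathfrak f\,\varpi^{(N,p)}_p=0$. Let $\varpi^{(N,p)}_{p+1}:=\mathfrak e\,\varpi^{(N,p)}_p$. Then: \begin{enumerate} \item For $l\in\{p,p+1\}$: $\mathcal E_1\varpi^{(N,p)}_l=(N-l)\varpi^{(N,p)}_l$, $\mathcal E_2\varpi^{(N,p)}_l=l(-1)^{l-1}\varpi^{(N,p)}_l$, $\mathfrak h\,\varpi^{(N,p)}_l=(-1)^l\varpi^{(N,p)}_l$; moreover $\mathfrak e\,\varpi^{(N,p)}_{p+1}=0$ and $\mathfrak f\,\varpi^{(N,p)}_{p+1}=(-1)^pN\,\varpi^{(N,p)}_p$. \item $\varpi^{(N,p)}_{p+1}\perp\varpi^{(N,p+1)}_{p+1}$ (for $p+1\le N-1$). \end{enumerate}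
   Context: $e_1,e_2$ is the standard basis of $\mathbb C^2$, $e_{x,y}$ are the elementary $2\times2$ matrices, $D=\mathrm{id}-2e_{2,2}=\mathrm{diag}(1,-1)$. The operators on $(\mathbb C^2)^{\otimes N}$ (images of the generators $e,f,h,\epsilon_1,\epsilon_2$ of the algebra $\mathfrak{gl}_{1,1}$ under the $N$-fold coproduct followed by the fundamental representation) are $$\mathfrak h=D^{\otimes N},\quad \mathfrak e=\sum_{j=1}^ND^{\otimes(j-1)}\otimes e_{2,1}\otimes\mathrm{id}^{\otimes(N-j)},\quad \mathfrak f=\sum_{j=1}^N\mathrm{id}^{\otimes(j-1)}\otimes e_{1,2}\otimes D^{\otimes(N-j)},$$ $$\mathcal E_1=\sum_{j=1}^N\mathrm{id}^{\otimes(j-1)}\otimes e_{1,1}\otimes\mathrm{id}^{\otimes(N-j)},\quad \mathcal E_2=\sum_{j=1}^ND^{\otimes(j-1)}\otimes e_{2,2}\otimes D^{\otimes(N-j)}.$$ ''Permutations of'' a pure tensor means all tensors obtained by permuting its factors; coefficients are complex. Orthogonality is with respect to the standard Hermitian inner product $\langle a,b\rangle=a^\dagger b$ on $(\mathbb C^2)^{\otimes N}$. In (2), $\varpi^{(N,p+1)}_{p+1}$ is any linear combination of the permutations of $\underbrace{e_1\otimes\cdots\otimes e_1}_{N-p-1}\otimes\underbrace{e_2\otimes\cdots\otimes e_2}_{p+1}$ such that $\mathfrak f\,\varpi^{(N,p+1)}_{p+1}=0$. *)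

(* Defs.v *)
From mathcomp Require Import all_boot all_order all_algebra all_fingroup.
From mathcomp Require Import reals complex.

Set Implicit Arguments.
Unset Strict Implicit.
Unset Printing Implicit Defensive.

Import Order.TTheory GRing.Theory Num.Theory.
Local Open Scope ring_scope.

(* The N-th tensor power of C^2, in coordinates with respect to the basis of
   pure tensors of standard basis vectors: that basis is indexed by the maps
   'I_N -> 'I_2.  The values lie in C^o so that the library's structure of
   C-module on finite functions applies. *)
Notation tpow C N := {ffun {ffun 'I_N -> 'I_2} -> C^o}.

Section TensorPower.

Variables (C : numClosedFieldType) (N : nat).

Definition tvec (u : 'I_N -> 'cV[C]_2) : tpow C N :=
  [ffun x : {ffun 'I_N -> 'I_2} => \prod_(i < N) u i (x i) 0].

Definition tmx (A : 'I_N -> 'M[C]_2) (v : tpow C N) : tpow C N :=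
  [ffun x : {ffun 'I_N -> 'I_2} =>
     \sum_(y : {ffun 'I_N -> 'I_2}) (\prod_(i < N) A i (x i) (y i)) * v y].

Lemma tmx_tvec (A : 'I_N -> 'M[C]_2) (u : 'I_N -> 'cV[C]_2) :
  tmx A (tvec u) = tvec (fun i => A i *m u i).
Proof.
apply/ffunP => x; rewrite !ffunE.
under [RHS]eq_bigr do rewrite mxE.
rewrite bigA_distr_bigA /=; apply: eq_bigr => y _.
by rewrite ffunE big_split.
Qed.

Definition tdot (a b : tpow C N) : C :=
  \sum_(x : {ffun 'I_N -> 'I_2}) (a x : C)^* * (b x : C).

(* The indices 1, 2 of the standard basis of C^2 are the elements 0, 1 of 'I_2. *)
Definition e1 : 'cV[C]_2 := delta_mx 0 0.
Definition e2 : 'cV[C]_2 := delta_mx 1 0.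
Definition e11 : 'M[C]_2 := delta_mx 0 0.
Definition e12 : 'M[C]_2 := delta_mx 0 1.
Definition e21 : 'M[C]_2 := delta_mx 1 0.
Definition e22 : 'M[C]_2 := delta_mx 1 1.
Definition D : 'M[C]_2 := 1%:M - 2 *: e22.

(* The factors of A ⊗ ... ⊗ A ⊗ X ⊗ B ⊗ ... ⊗ B with X in position j. *)
Definition insert_at (A X B : 'M[C]_2) (j i : 'I_N) : 'M[C]_2 :=
  if (i < j)%N then A else if i == j then X else B.

Definition h_op (v : tpow C N) : tpow C N := tmx (fun=> D) v.

Definition e_op (v : tpow C N) : tpow C N :=
  \sum_(j < N) tmx (insert_at D e21 1%:M j) v.

Definition f_op (v : tpow C N) : tpow C N :=
  \sum_(j < N) tmx (insert_at 1%:M e12 D j) v.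

Definition E1_op (v : tpow C N) : tpow C N :=
  \sum_(j < N) tmx (insert_at 1%:M e11 1%:M j) v.

Definition E2_op (v : tpow C N) : tpow C N :=
  \sum_(j < N) tmx (insert_at D e22 D j) v.

(* The factors of e1 ⊗ ... ⊗ e1 ⊗ e2 ⊗ ... ⊗ e2 with p factors e2. *)
Definition e1s_e2s (p : nat) (i : 'I_N) : 'cV[C]_2 :=
  if (i < N - p)%N then e1 else e2.

Definition lin_comb_perms (p : nat) (v : tpow C N) : Prop :=
  exists c : 'S_N -> C,
    v = \sum_(s : 'S_N) c s *: tvec (fun i => e1s_e2s p (s i)).

End TensorPower.

(* Main.v *)
(** The operators satisfy [e e = 0] and [f e - e f = N h], which give the last
    two claims of (1), since [h] acts as [(-1)^p] on weight [p].  The other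
    claims of (1) hold because a permuted pure tensor is supported on the basis
    tensors with exactly [p] factors [e_2], and [e] raises this number by one.
    For (2), the adjoint of [e] carries its matrices [D] on the other side of
    [e_{1,2}] than [f] does; as [D ⊗ ... ⊗ D] is a sign on vectors of fixed
    weight, this adjoint agrees with [f] up to sign there. *)
Require Import Defs.
From mathcomp Require Import all_boot all_order all_algebra all_fingroup.
From mathcomp Require Import reals complex.
From HB Require Import structures.
From mathcomp Require Import zify ring.

Set Implicit Arguments.
Unset Strict Implicit.
Unset Printing Implicit Defensive.

Import Order.TTheory GRing.Theory Num.Theory.
Local Open Scope ring_scope.

(** * Products of the 2x2 matrices *)

Section Matrices.

Variable C : numClosedFieldType.

Local Ltac mx2 :=
  apply/matrixP => -[[|[|//]] ?] -[[|[|//]] ?];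
  rewrite !mxE ?big_ord_recl ?big_ord0 ?mxE;
  rewrite /= ?mulr1n ?mulr0n; ring.

Lemma mulDD : D C *m D C = 1%:M. Proof. mx2. Qed.
Lemma mulDe21 : D C *m e21 C = - e21 C. Proof. mx2. Qed.
Lemma mule21D : e21 C *m D C = e21 C. Proof. mx2. Qed.
Lemma mulDe12 : D C *m e12 C = e12 C. Proof. mx2. Qed.
Lemma mule12D : e12 C *m D C = - e12 C. Proof. mx2. Qed.
Lemma mule22D : e22 C *m D C = - e22 C. Proof. mx2. Qed.
Lemma mule12e21 : e12 C *m e21 C = D C + e21 C *m e12 C. Proof. mx2. Qed.
Lemma mule21e21 : e21 C *m e21 C = 0. Proof. mx2. Qed.

Lemma DE (a b : 'I_2) : D C a b = (a == b)%:R * (-1) ^+ a.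
Proof.
rewrite !mxE; case: a => [[|[|//]] ?]; case: b => [[|[|//]] ?];
  rewrite /= ?mulr1n ?mulr0n; ring.
Qed.

End Matrices.

(** * Tensor products of matrices acting on the tensor power *)

Section Operators.

Variables (C : numClosedFieldType) (N : nat).
Implicit Types (A B : 'I_N -> 'M[C]_2) (v w : tpow C N) (j k : 'I_N).
Implicit Types (x y : {ffun 'I_N -> 'I_2}).

Lemma tmxE A v x :
  tmx A v x =
    \sum_(y : {ffun 'I_N -> 'I_2}) (\prod_(i < N) A i (x i) (y i)) * v y.
Proof. by rewrite ffunE. Qed.

Lemma tmx_is_linear A : linear (tmx A).
Proof.
move=> a u v; apply/ffunP => x; rewrite !ffunE scaler_sumr -big_split /=.
apply: eq_bigr => y _; rewrite !ffunE mulrDr; congr (_ + _).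
exact: mulrCA.
Qed.

HB.instance Definition _ A :=
  GRing.isLinear.Build C (tpow C N) (tpow C N) _ (tmx A) (tmx_is_linear A).

Lemma tmx_comp A B v : tmx A (tmx B v) = tmx (fun i => A i *m B i) v.
Proof.
apply/ffunP => x; rewrite !tmxE.
under eq_bigr do rewrite tmxE mulr_sumr.
rewrite exchange_big /=; apply: eq_bigr => z _.
under [X in _ = X * _]eq_bigr do rewrite mxE.
rewrite bigA_distr_bigA /= mulr_suml; apply: eq_bigr => y _.
by rewrite big_split /= mulrA.
Qed.

(** Multilinearity in the factors. Most signs below are extracted this way: two products of
    operators are compared slot by slot, and the scalars of the slots are multiplied. *)
Lemma tmx_scale (c : 'I_N -> C) A B v :
  (forall i, A i = c i *: B i) -> tmx A v = (\prod_i c i) *: tmx B v.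
Proof.
move=> AB; apply/ffunP => x; rewrite !ffunE scaler_sumr; apply: eq_bigr => y _.
under [in LHS]eq_bigr do rewrite AB mxE.
by rewrite big_split /= -mulrA.
Qed.

Lemma eq_tmx A B v : (forall i, A i = B i) -> tmx A v = tmx B v.
Proof.
move=> AB; rewrite (@tmx_scale (fun=> 1) _ B) ?big1 ?scale1r // => i.
by rewrite scale1r AB.
Qed.

Lemma prod_at j (a : C) : \prod_i (if i == j then a else 1) = a.
Proof. by rewrite -big_mkcond big_pred1_eq. Qed.

Lemma tmx_opp_at j A B v :
  (forall i, A i = if i == j then - B i else B i) -> tmx A v = - tmx B v.
Proof.
move=> AB; rewrite (@tmx_scale (fun i => if i == j then -1 else 1) _ B).
  by rewrite prod_at scaleN1r.
by move=> i; rewrite AB; case: eqP; rewrite ?scaleN1r ?scale1r.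
Qed.

Lemma tmx_add_at j A B B' v :
  (forall i, i != j -> A i = B i) -> (forall i, i != j -> A i = B' i) ->
  A j = B j + B' j -> tmx A v = tmx B v + tmx B' v.
Proof.
move=> AB AB' Aj; apply/ffunP => x; rewrite !ffunE -big_split /=.
apply: eq_bigr => y _; rewrite -mulrDl; congr (_ * _).
have prodj (M : 'I_N -> 'M[C]_2) : \prod_i M i (x i) (y i) =
    M j (x j) (y j) * \prod_(i | i != j) M i (x i) (y i) by rewrite (bigD1 j).
rewrite !prodj Aj mxE mulrDl; congr (_ * _ + _ * _); apply: eq_bigr => i ij.
  by rewrite AB.
by rewrite AB'.
Qed.

Lemma tmx_eq0 A v j : A j = 0 -> tmx A v = 0.
Proof.
move=> Aj; apply/ffunP => x; rewrite !ffunE big1 // => y _.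
by rewrite (bigD1 j) //= Aj mxE !mul0r.
Qed.

(** An index [y] other than [x] differs from it at some slot, where the off-diagonal entry kills the
    whole product. *)
Lemma tmx_diag A v x : (forall i a b, a != b -> A i a b = 0) ->
  tmx A v x = (\prod_i A i (x i) (x i)) * v x.
Proof.
move=> dA; rewrite tmxE (bigD1 x) //= [X in _ + X]big1 ?addr0 // => y yx.
have [i xy] : exists i, x i != y i.
  apply/existsP; apply: contraNT yx => /existsPn xy; apply/eqP/ffunP => i.
  by have /negPn/eqP := xy i.
by rewrite (bigD1 i) //= dA // !mul0r.
Qed.

Lemma tmx_diag_at j (X : 'M[C]_2) v x : (forall a b, a != b -> X a b = 0) ->
  tmx (insert_at 1%:M X 1%:M j) v x = X (x j) (x j) * v x.
Proof.
move=> dX; rewrite tmx_diag.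
  congr (_ * _); rewrite -[RHS](prod_at j); apply: eq_bigr => i _.
  rewrite /insert_at; case: ltngtP => ij.
  - by rewrite mxE eqxx -val_eqE ltn_eqF.
  - by rewrite -val_eqE gtn_eqF // mxE eqxx.
  - by rewrite (val_inj ij) eqxx.
move=> i a b ab; rewrite /insert_at.
by case: ifP => _; [|case: ifP => _]; rewrite ?dX // mxE (negPf ab).
Qed.

(** * Relations between the raising and lowering operators *)

Lemma e_op_e_op v : e_op (e_op v) = 0.
Proof.
set E := fun j => tmx (insert_at (D C) (e21 C) 1%:M j).
(* The two orders differ only at slot [j], where [E k] carries [D]: there [e21 D = e21] but
   [D e21 = - e21]. *)
have anti j k : (j < k)%N -> E j (E k v) = - E k (E j v).
  move=> jk; rewrite /E !tmx_comp; apply: (@tmx_opp_at j) => i.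
  rewrite /insert_at -!val_eqE.
  case: (ltngtP i j) => ij; case: (ltngtP i k) => ik; try lia;
    by rewrite ?mulDe21 ?mule21D ?mulmx1 ?mul1mx ?opprK.
have sq j : E j (E j v) = 0.
  rewrite /E tmx_comp; apply: (@tmx_eq0 _ _ j).
  by rewrite /insert_at ltnn eqxx mule21e21.
have eeE : e_op (e_op v) = \sum_j \sum_k E j (E k v).
  by apply: eq_bigr => j _; rewrite /e_op linear_sum.
(* Swapping the two summation indices negates every term, and a vector equal to its opposite
   vanishes since 2 is invertible. *)
have eeN : e_op (e_op v) = - e_op (e_op v).
  rewrite {1}eeE exchange_big eeE /= -sumrN; apply: eq_bigr => j _.
  rewrite -sumrN; apply: eq_bigr => k _.
  case: (ltngtP j k) => jk.
  - by rewrite (anti j k) // opprK.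
  - by rewrite anti.
  - by rewrite (val_inj jk) sq oppr0.
apply/eqP; have /eqP := eeN; rewrite -addr_eq0 -mulr2n -scaler_nat scaler_eq0.
by rewrite pnatr_eq0.
Qed.

(** Summands at different slots commute, so only the [N] diagonal terms contribute to the
    commutator, and each contributes one copy of [h_op]. *)
Lemma f_op_e_op v : f_op (e_op v) = N%:R *: h_op v + e_op (f_op v).
Proof.
set E := fun j => tmx (insert_at (D C) (e21 C) 1%:M j).
set F := fun j => tmx (insert_at 1%:M (e12 C) (D C) j).
have comm j k : j != k -> F k (E j v) = E j (F k v).
  move=> jk; rewrite /E /F !tmx_comp.
  (* If [k < j], each operator puts a [D] on the special slot of the other, so exchanging them gives
     a sign at [j] and another at [k], which cancel. If [j < k], those slots carry identities. *)
  pose s : C := if (k < j)%N then -1 else 1.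
  rewrite (@tmx_scale (fun i =>
    (if i == j then s else 1) * (if i == k then s else 1)) _
    (fun i => insert_at (D C) (e21 C) 1%:M j i *m
              insert_at 1%:M (e12 C) (D C) k i)).
    rewrite big_split /= !prod_at /s.
    by case: ifP => _; rewrite ?mulrNN mul1r scale1r.
  move: jk => + i; rewrite /s /insert_at -!val_eqE /=.
  case: (ltngtP j k) => jk // _;
  case: (ltngtP i j) => ij; case: (ltngtP i k) => ik; try lia;
    by rewrite ?mulDe21 ?mule21D ?mulDe12 ?mule12D ?mulmx1 ?mul1mx
       ?mulr1 ?mul1r ?scale1r ?scaleN1r ?opprK.
(* In either order [E] leaves [D] to the left of [j] and [F] leaves [D] to the right. At [j],
   [e12 e21 = D + e21 e12], and its first term completes [D] in every slot. *)
have diag j : F j (E j v) = h_op v + E j (F j v).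
  rewrite /E /F !tmx_comp; apply: (@tmx_add_at j) => [i|i|];
    rewrite /insert_at -?val_eqE ?ltnn ?eqxx ?mule12e21 //;
    by case: ltngtP => // ij _; rewrite ?mulmx1 ?mul1mx.
have -> : f_op (e_op v) = \sum_j \sum_k F j (E k v).
  by apply: eq_bigr => j _; rewrite /e_op linear_sum.
have -> : e_op (f_op v) = \sum_j \sum_k E j (F k v).
  by apply: eq_bigr => j _; rewrite /f_op linear_sum.
rewrite [X in _ + X]exchange_big /=.
have -> : N%:R *: h_op v = \sum_(j < N) h_op v.
  by rewrite sumr_const card_ord scaler_nat.
rewrite -big_split /=; apply: eq_bigr => j _.
rewrite (bigD1 j) //= [X in _ = _ + X](bigD1 j) //= diag addrA; congr (_ + _).
by apply: eq_bigr => k kj; rewrite comm.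
Qed.

(** * Vectors of fixed weight and the diagonal operators *)

Definition weight x : nat := \sum_i x i.

Definition supp_weight (p : nat) v := forall x, v x != 0 -> weight x = p.

Lemma lin_comb_perms_supp p v :
  (p <= N)%N -> lin_comb_perms p v -> supp_weight p v.
Proof.
move=> pN [c ->] x; rewrite sum_ffunE => nz.
have [s] : exists s : 'S_N, tvec (fun i => e1s_e2s C p (s i)) x != 0.
  apply/existsP; apply: contraNT nz => /existsPn z; rewrite big1 // => s _.
  have /negPn/eqP := z s; rewrite [X in _ -> X = _]ffunE => ->.
  exact: scaler0.
rewrite ffunE => /prodf_neq0 nz'.
(* A nonzero coordinate forces [x i] to be the index of the basis vector in slot [i]. Reindexing by
   [s] then sorts the factors. *)
transitivity (\sum_(i < N) (N - p <= s i)%N)%N.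
  apply: eq_bigr => i _; have := nz' i isT; rewrite /e1s_e2s.
  case: ltnP => _; rewrite !mxE; case: (x i) => [[|[|//]] ?] //=;
  by rewrite ?mulr0n ?eqxx.
rewrite -(reindex_inj (@perm_inj _ s)
  (F := fun i : 'I_N => (N - p <= i)%N : nat) (P := predT)) /=.
rewrite -(big_mkord predT (fun i => (N - p <= i)%N : nat)).
rewrite (@big_cat_nat _ _ _ (N - p)) ?leq_subr //= big_nat big1; last first.
  by move=> i /andP[_ ?]; rewrite leqNgt; case: ltnP; lia.
rewrite big_nat (eq_bigr (fun=> 1%N)); last by move=> i /andP[-> _].
(* The truncated difference [N - (N - p)] equals [p] because [p <= N]. *)
by rewrite -big_nat sum_nat_const_nat; lia.
Qed.

(** A nonzero coordinate at [x] comes from some [y] in the support of [v]. The diagonal factors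
    force [x] and [y] to agree off [j], and [e21] forces the entry at [j] to pass from 0 to 1. *)
Lemma e_op_supp p v : supp_weight p v -> supp_weight p.+1 (e_op v).
Proof.
move=> sv x; rewrite sum_ffunE => nz.
have [j] : exists j, tmx (insert_at (D C) (e21 C) 1%:M j) v x != 0.
  apply/existsP; apply: contraNT nz => /existsPn z; rewrite big1 // => j _.
  by have /negPn/eqP := z j.
rewrite tmxE => nzj.
have [y] : exists y,
    (\prod_i insert_at (D C) (e21 C) 1%:M j i (x i) (y i)) * v y != 0.
  apply/existsP; apply: contraNT nzj => /existsPn z; rewrite big1 // => y _.
  by have /negPn/eqP := z y.
rewrite mulf_eq0 negb_or => /andP[/prodf_neq0 nzy /sv <-].
transitivity (\sum_i (y i + (i == j)))%N.
  apply: eq_bigr => i _; have := nzy i isT; rewrite /insert_at -val_eqE.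
  case: ltngtP => ij; rewrite ?DE ?mxE ?addn0.
  - by case: (x i =P y i) => [->|] //=; rewrite mul0r eqxx.
  - by case: (x i =P y i) => [->|] //=; rewrite eqxx.
  - case: (x i) => [[|[|//]] ?]; case: (y i) => [[|[|//]] ?] //=;
    by rewrite eqxx.
rewrite big_split /= -/(weight y) (bigD1 j) //= eqxx big1 ?addn0 ?addn1 //.
by move=> i /negPf ->.
Qed.

Lemma h_op_supp p v : supp_weight p v -> h_op v = (-1) ^+ p *: v.
Proof.
move=> sv; apply/ffunP => x; rewrite tmx_diag => [|i a b /negPf ab].
  rewrite [RHS]ffunE.
  under eq_bigr do rewrite DE eqxx mul1r.
  rewrite -expr_sum -/(weight x).
  by have [->|/sv ->//] := eqVneq (v x) 0; rewrite mulr0 scaler0.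
by rewrite DE ab mul0r.
Qed.

(** This sum is the number operator, which counts the factors [e2]. Both [E1_op] and [E2_op] are
    reduced to it. *)
Lemma sum_e22_supp p v : supp_weight p v ->
  \sum_j tmx (insert_at 1%:M (e22 C) 1%:M j) v = p%:R *: v.
Proof.
move=> sv; apply/ffunP => x; rewrite sum_ffunE [RHS]ffunE.
have d a b : a != b -> e22 C a b = 0.
  by case: a => [[|[|//]] ?]; case: b => [[|[|//]] ?]; rewrite mxE.
under eq_bigr do rewrite tmx_diag_at //.
have -> : p%:R *: v x = (weight x)%:R * v x.
  by have [->|/sv ->//] := eqVneq (v x) 0; rewrite mulr0 scaler0.
rewrite -mulr_suml natr_sum; congr (_ * _); apply: eq_bigr => i _.
by rewrite mxE; case: (x i) => [[|[|//]] ?].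
Qed.

(** Splitting the identity as [e11 + e22] at each slot shows that [E1_op] and the number operator
    add up to [N]. *)
Lemma E1_op_supp p v : supp_weight p v -> E1_op v = (N%:R - p%:R) *: v.
Proof.
move=> sv; rewrite scalerBl -(sum_e22_supp sv).
apply/eqP; rewrite eq_sym subr_eq -big_split /=; apply/eqP.
have -> : N%:R *: v = \sum_(j < N) v by rewrite sumr_const card_ord scaler_nat.
apply: eq_bigr => j _.
have {1}-> : v = tmx (fun=> 1%:M) v.
  apply/ffunP => x; rewrite tmx_diag => [|i a b /negPf ab].
    by rewrite big1 ?mul1r // => i _; rewrite mxE eqxx.
  by rewrite mxE ab.
apply: (@tmx_add_at j) => [i|i|]; rewrite /insert_at ?ltnn ?eqxx.
- by case: ifP => // _ /negPf ->.
- by case: ifP => // _ /negPf ->.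
apply/matrixP => a b; rewrite !mxE.
by case: a => [[|[|//]] ?]; case: b => [[|[|//]] ?]; rewrite /= ?addr0 ?add0r.
Qed.

(** This inserts a [D] in every slot at the cost of a sign, so that [D D = 1] can turn strings of
    [D] into identities and conversely. *)
Lemma supp_h_opK p v : supp_weight p v -> v = (-1) ^+ p *: h_op v.
Proof.
by move=> /h_op_supp ->; rewrite scalerA -exprMn mulrNN mul1r expr1n scale1r.
Qed.

Lemma E2_op_supp p v :
  supp_weight p v -> E2_op v = (p%:R * (-1) ^ (p%:Z - 1)) *: v.
Proof.
(* The exponent is an integer, so it is -1 at [p = 0]. The minus sign in front matches
   [e22 D = - e22] at slot [j]. *)
move=> sv; have -> : p%:R * (-1) ^ (p%:Z - 1) = - (-1) ^+ p * p%:R :> C.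
  by rewrite expfzDr ?oppr_eq0 ?oner_eq0 // exprN1 invrN invr1 -exprnP; ring.
rewrite -scalerA -(sum_e22_supp sv) scaler_sumr.
apply: eq_bigr => j _; rewrite [in LHS](supp_h_opK sv) linearZ /=.
rewrite scaleNr -scalerN; congr (_ *: _).
rewrite /h_op tmx_comp; apply: (@tmx_opp_at j) => i; rewrite /insert_at.
case: ifP => [ij|_]; last by case: eqP; rewrite ?mulDD ?mule22D.
by rewrite mulDD -val_eqE ltn_eqF.
Qed.

(** * Inner product and adjoints *)

Lemma tdot_tmx A v w :
  tdot (tmx A v) w = tdot v (tmx (fun i => (map_mx Num.conj (A i))^T) w).
Proof.
rewrite /tdot; under eq_bigr do rewrite tmxE rmorph_sum mulr_suml.
rewrite exchange_big /=; apply: eq_bigr => y _.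
rewrite tmxE mulr_sumr; apply: eq_bigr => x _.
rewrite rmorphM rmorph_prod /=.
under [in RHS]eq_bigr do rewrite !mxE.
by rewrite mulrA [_^* * _]mulrC.
Qed.

Lemma tdot_suml (I : finType) (u : I -> tpow C N) w :
  tdot (\sum_i u i) w = \sum_i tdot (u i) w.
Proof.
rewrite /tdot exchange_big /=; apply: eq_bigr => x _.
by rewrite sum_ffunE rmorph_sum mulr_suml.
Qed.

Lemma tdot_sumr (I : finType) v (u : I -> tpow C N) :
  tdot v (\sum_i u i) = \sum_i tdot v (u i).
Proof.
rewrite /tdot exchange_big /=; apply: eq_bigr => x _.
by rewrite sum_ffunE mulr_sumr.
Qed.

Lemma tdotZr (a : C) v w : tdot v (a *: w) = a * tdot v w.
Proof.
by rewrite mulr_sumr; apply: eq_bigr => x _; rewrite ffunE; apply: mulrCA.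
Qed.

(** The adjoint of a summand of [e_op] has [D] to the left of [e12]. Composing it with [h_op] moves
    the [D] to the right, and [e12 D = - e12] gives a sign that turns the [(-1) ^+ p.+1] from the
    weight of [w] into [(-1) ^+ p]. *)
Lemma tdot_e_op p v w :
  supp_weight p.+1 w -> tdot (e_op v) w = (-1) ^+ p * tdot v (f_op w).
Proof.
move=> sw; rewrite tdot_suml tdot_sumr mulr_sumr; apply: eq_bigr => j _.
rewrite tdot_tmx -tdotZr; congr (tdot _ _).
rewrite [in LHS](supp_h_opK sw) linearZ /= exprS mulN1r scaleNr -scalerN.
congr (_ *: _); apply/eqP; rewrite eqr_oppLR; apply/eqP.
rewrite /h_op tmx_comp; apply: (@tmx_opp_at j) => i; rewrite /insert_at.
have cD : (map_mx Num.conj (D C))^T = D C.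
  apply/matrixP => a b; rewrite mxE mxE !DE eq_sym.
  case: eqP => [->|_]; rewrite ?mul1r ?mul0r ?rmorph0 //.
  by rewrite rmorphXn rmorphN rmorph1.
have ce : (map_mx Num.conj (e21 C))^T = e12 C.
  by rewrite map_delta_mx trmx_delta.
case: ifP => [ij|_]; first by rewrite cD mulDD -val_eqE ltn_eqF.
by case: eqP; rewrite ?ce ?mule12D // map_mx1 trmx1 mul1mx.
Qed.

End Operators.

Theorem proposition4p3 (R : realType) (N p : nat) (varpi : nat -> tpow R[i] N)
    (hN : (1 <= N)%N) (hp : (p <= N - 1)%N)
    (hperm : lin_comb_perms p (varpi p))
    (hf : f_op (varpi p) = 0)
    (he : varpi p.+1 = e_op (varpi p)) :
  [/\ forall l : nat, l = p \/ l = p.+1 ->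
        [/\ E1_op (varpi l) = (N%:R - l%:R : R[i]) *: varpi l,
            E2_op (varpi l) = (l%:R * (-1) ^ (l%:Z - 1) : R[i]) *: varpi l
          & h_op (varpi l) = ((-1) ^+ l : R[i]) *: varpi l],
      e_op (varpi p.+1) = 0,
      f_op (varpi p.+1) = ((-1) ^+ p * N%:R : R[i]) *: varpi p
    & (p + 1 <= N - 1)%N ->
      forall varpi' : tpow R[i] N,
        lin_comb_perms p.+1 varpi' -> f_op varpi' = 0 ->
        tdot (varpi p.+1) varpi' = 0].
Proof.
have sp : supp_weight p (varpi p) by apply: lin_comb_perms_supp => //; lia.
have sp1 : supp_weight p.+1 (varpi p.+1) by rewrite he; apply: e_op_supp.
split.
- move=> l lp; have sl : supp_weight l (varpi l) by case: lp => ->.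
  by split; [apply: E1_op_supp | apply: E2_op_supp | apply: h_op_supp].
- by rewrite he e_op_e_op.
- have e0 : e_op (0 : tpow R[i] N) = 0 by apply: big1 => j _; apply: linear0.
  by rewrite he f_op_e_op hf e0 addr0 (h_op_supp sp) scalerA mulrC.
- move=> pN w hw fw; have sw : supp_weight p.+1 w.
    by apply: lin_comb_perms_supp => //; lia.
  (* Moving [e_op] across the inner product lets [f_op] act on [w], which it annihilates. *)
  rewrite he (tdot_e_op _ sw) fw.
  by rewrite /tdot big1 ?mulr0 // => x _; rewrite ffunE mulr0.
Qed.
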